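(* Let $(K,\prec_K)$ be an abstract elementary class with the $\lambda$-amalgamation property, where $\lambda\ge LS(K)$. Then for every $n<\omega$, $\mathfrak{tb}^n_\lambda\le\mathfrak{tb}^1_\lambda$.
   Context: An abstract elementary class (AEC) is a pair $(K,\prec_K)$ with $K$ a class of structures in a fixed language $L(K)$ and $\prec_K$ a partial order on $K$ such that: $M\prec_K N$ implies $M$ is an $L(K)$-substructure of $N$; $K$ and $\prec_K$ are closed under $L(K)$-isomorphisms; (coherence) if $M_0,M_1\prec_K M_2$ and $M_0\subseteq M_1$ then $M_0\prec_K M_1$; (Tarski–Vaught) the union of a $\prec_K$-increasing continuous chain is in $K$ and $\prec_K$-extends each member, and if each member is $\prec_K N$ then so is the union; and $LS(K)$ is the least infinite cardinal $\ge|L(K)|$ such that for any $M\in K$ and $A\subseteq M$ there is $N\prec_K M$ with $A\subseteq N$ and $\|N\|\le|A|+LS(K)$. $K$ has no models of size $<LS(K)$. $\|M\|$ is the cardinality of $M$, $K_\lambda=\{M\in K:\|M\|=\lambda\}$. A $K$-embedding $f:M\to N$ is an $L(K)$-embedding with $f(M)\prec_K N$. $\lambda$-amalgamation property: whenever $M\prec_K N_0$, $M\prec_K N_1$ with $M,N_0,N_1\in K_\lambda$, there are $N^*\in K$ and $K$-embeddings $f_\ell:N_\ell\to N^*$ ($\ell=0,1$) agreeing on $M$. Galois types: for $M\in K$ and an index set $I$, a pretype is a triple $(\langle a_i:i\in I\rangle,M,N)$ with $M\prec_K N$, $\|N\|=\|M\|+|I|$, and each $a_i\in N$. Two pretypes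 $(\langle a_i\rangle,M,N)$, $(\langle b_i\rangle,M,N')$ over the same $M$ are atomically equivalent if there are $N^*\in K$ and $K$-embeddings $f:N\to N^*$, $g:N'\to N^*$ with $f\upharpoonright M=g\upharpoonright M$ and $f(a_i)=g(b_i)$ for all $i\in I$; $\sim$ is the transitive closure of this relation, $gtp(\langle a_i\rangle/M,N)$ is the $\sim$-class, and $gS^I(M)$ is the set of all such classes; for a cardinal $\kappa$, $gS^\kappa(M)$ uses $I=\kappa$. The type bound is $\mathfrak{tb}^\kappa_\lambda=\sup_{M\in K_\lambda}|gS^\kappa(M)|$. *)

(* Defs.v *)
From mathcomp Require Export all_boot.
From mathcomp Require Export boolp classical_sets functions cardinality wochoice.
From Stdlib Require Export Relation_Operators.

Set Implicit Arguments.
Unset Strict Implicit.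
Unset Printing Implicit Defensive.

Local Open Scope classical_set_scope.
Local Open Scope card_scope.

(* Cardinals are represented by types, compared through [#<=] and [#=].       *)

Definition card_ub (J : Type) (F : J -> Type) (T : Type) (B : set T) : Prop :=
  forall j, [set: F j] #<= B.

Definition is_card_sup (J : Type) (F : J -> Type) (T : Type) (B : set T) : Prop :=
  card_ub F B /\ forall (U : Type) (C : set U), card_ub F C -> B #<= C.

(* Cardinals are well-ordered: take a maximal set of choice functions all of  *)
(* whose evaluations are injective; one evaluation must then be onto.         *)
Lemma card_min (S J : Type) (A : J -> set S) :
  inhabited J -> exists i, forall j, A i #<= A j.
Proof.
case=> j0.
pose P (X : set (J -> S)) :=
  (forall f, X f -> forall j, A j (f j)) /\
  (forall f g j, X f -> X g -> f j = g j -> f = g).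
have [F FP Ftot|X [[XA Xinj] Xmax]] := @Zorn_bigcup _ P.
  split=> [f [Y /FP[YA _] /YA //]|f g j [Y FY Yf] [Z FZ Zg]].
  have [YZ|ZY] := Ftot _ _ FY FZ.
  - by have [_] := FP _ FZ; apply=> //; apply: YZ.
  - by have [_] := FP _ FY; apply=> //; apply: ZY.
have [[i Ai]|noi] := pselect (exists i, forall a, A i a -> exists2 f, X f & f i = a).
  exists i => j; apply: (@card_le_trans _ _ _ X).
    apply: card_le_trans (card_image_le (fun f : J -> S => f i) X).
    exact: subset_card_le.
  rewrite -(@card_le_eql _ _ _ ((fun f : J -> S => f j) @` X)); last first.
    by apply: inj_card_eq => f g /set_mem Xf /set_mem Xg; apply: Xinj.
  by apply: subset_card_le => _ [f Xf <-]; apply: XA.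
have {noi} /choice[g gP] : forall j, exists a, A j a /\ ~ exists2 f, X f & f j = a.
  move=> j; apply: contrapT => noa; apply: noi; exists j => a Aa.
  by apply: contrapT => nof; apply: noa; exists a.
case: (Xmax (X `|` [set g])).
  split=> [f Xf|XgX]; first by left.
  by case: (gP j0) => _ []; exists g => //; apply: XgX; right.
split=> [f [/XA//|->] j|f h j]; first by have [] := gP j.
case=> [Xf|->] [Xh|->] // e.
- exact: Xinj e.
- by have [_ []] := gP j; exists f.
- by have [_ []] := gP j; exists h.
Qed.

Lemma card_le_total (T U : Type) (A : set T) (B : set U) : A #<= B \/ B #<= A.
Proof.
have lA : @inl T U @` A #= A by apply: inj_card_eq => x y _ _ [].
have rB : @inr T U @` B #= B by apply: inj_card_eq => x y _ _ [].
pose F b : set (T + U) := if b then inl @` A else inr @` B.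
have [[] iP] := card_min F (inhabits true).
- by left; rewrite -(card_le_eql lA) -(card_le_eqr rB); apply: (iP false).
- by right; rewrite -(card_le_eql rB) -(card_le_eqr lA); apply: (iP true).
Qed.

Lemma card_sup_exists (J : Type) (F : J -> Type) :
  exists B : set {j & F j}, is_card_sup F B.
Proof.
pose S := {j & F j}.
have ubT : card_ub F [set: S].
  move=> j; have e : existT F j @` [set: F j] #= [set: F j].
    apply: inj_card_eq => x y _ _ exy; have /= := projT2_eq exy.
    by rewrite (Prop_irrelevance (projT1_eq exy) erefl).
  by rewrite -(card_le_eql e); apply: card_leT.
pose G (B : {B : set S | card_ub F B}) := sval B.
have [[B ubB] Bmin] := card_min G (inhabits (exist _ _ ubT)).
exists B; split=> // U C ubC.
have [CS|SC] := card_le_total C [set: S]; last exact: card_le_trans (card_leT _) SC.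
have /card_subP[D DC _] := CS.
have ubD : card_ub F D by move=> j; rewrite (card_le_eqr DC).
by rewrite -(card_le_eqr DC); apply: (Bmin (exist _ D ubD)).
Qed.

Definition card_sup (J : Type) (F : J -> Type) : set {j & F j} :=
  sval (cid (card_sup_exists F)).
Arguments card_sup {J} F.

Lemma card_supP (J : Type) (F : J -> Type) : is_card_sup F (card_sup F).
Proof. exact: svalP (cid (card_sup_exists F)). Qed.

Record language := Language {
  fsym : Type;
  far : fsym -> nat;
  rsym : Type;
  rar : rsym -> nat
}.

Record structure (L : language) := Structure {
  carrier :> Type;
  finterp : forall s : fsym L, ('I_(far s) -> carrier) -> carrier;
  rinterp : forall s : rsym L, ('I_(rar s) -> carrier) -> Prop
}.

Record substructure (L : language) (N : structure L) := Substructure {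
  dom : set N;
  dom_closed : forall (s : fsym L) (x : 'I_(far s) -> N),
    (forall i, dom (x i)) -> dom (finterp x)
}.

(* [{x | dom A x}] rather than the coercion of [dom A] to a type: the latter  *)
(* would bound the universe of carriers from below.                           *)
Definition induced (L : language) (N : structure L) (A : substructure N) :
    structure L :=
  @Structure L {x : N | dom A x}
    (fun s x => exist _ (finterp (fun i => sval (x i)))
                        (dom_closed (fun i => svalP (x i))))
    (fun s x => rinterp (fun i => sval (x i))).

Lemma full_closed (L : language) (N : structure L) (s : fsym L)
    (x : 'I_(far s) -> N) :
  (forall i, [set: N] (x i)) -> [set: N] (finterp x).
Proof. by []. Qed.

Definition full (L : language) (N : structure L) : substructure N :=
  Substructure (@full_closed L N).

Lemma relativize_closed (L : language) (N : structure L) (A B : substructure N)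
    (s : fsym L) (x : 'I_(far s) -> induced B) :
  (forall i, dom A (sval (x i))) -> dom A (sval (finterp x)).
Proof. exact: dom_closed. Qed.

(* [A], when [dom A `<=` dom B], seen as a substructure of [B]. *)
Definition relativize (L : language) (N : structure L) (A B : substructure N) :
    substructure (induced B) :=
  @Substructure L (induced B) [set x | dom A (sval x)]
    (@relativize_closed L N A B).

Record embedding (L : language) (M N : structure L) (f : M -> N) : Prop :=
  Embedding {
    emb_inj : injective f;
    emb_fun : forall (s : fsym L) (x : 'I_(far s) -> M),
      f (finterp x) = finterp (f \o x);
    emb_rel : forall (s : rsym L) (x : 'I_(rar s) -> M),
      rinterp x <-> rinterp (f \o x)
  }.

Definition isomorphism (L : language) (M N : structure L) (f : M -> N) : Prop :=
  embedding f /\ range f = [set: N].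

(* There is no inclusion between distinct types, so a substructure M of N is  *)
(* given as the structure induced on a closed subset of N, and a strong       *)
(* substructure relation is a predicate [prec A] on the substructures [A] of  *)
(* each structure N.                                                          *)
Section Chains.
Variables (L : language) (prec : forall N : structure L, substructure N -> Prop).

Definition prec_in (N : structure L) (A B : substructure N) : Prop :=
  dom A `<=` dom B /\ prec (relativize A B).

Definition limit_index (I : Type) (R : rel I) (i : I) : Prop :=
  let lt j k := R j k /\ j <> k in
  (exists j, lt j i) /\ (forall j, lt j i -> exists k, lt j k /\ lt k i).

Record continuous_chain (N : structure L) (I : Type) (R : rel I)
    (A : I -> substructure N) : Prop := ContinuousChain {
  chain_index : well_order R;
  chain_inhabited : inhabited I;
  chain_incr : forall i j, R i j -> prec_in (A i) (A j);
  chain_cont : forall i, limit_index R i ->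
    dom (A i) = \bigcup_(j in [set j | R j i /\ j <> i]) dom (A j)
}.

End Chains.

Section LowenheimSkolem.
Variables (L : language) (K : structure L -> Prop).
Variable prec : forall N : structure L, substructure N -> Prop.

Definition LS_bound (kappa : Type) : Prop :=
  [/\ infinite_set [set: kappa],
      [set: (fsym L + rsym L)%type] #<= [set: kappa] &
      forall (M : structure L) (X : set M), K M ->
        exists A : substructure M,
          [/\ prec A, X `<=` dom A &
              dom A #<= [set: ({x | X x} + kappa)%type]]].

Definition is_LS (kappa : Type) : Prop :=
  LS_bound kappa /\
  forall mu : Type, LS_bound mu -> [set: kappa] #<= [set: mu].

End LowenheimSkolem.

(* Antisymmetry of [prec] holds by construction. In [aec_union], N is the     *)
(* union of the chain: every chain is a chain of substructures of its union.  *)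
Record AEC (L : language) := MkAEC {
  aec_in :> structure L -> Prop;
  prec : forall N : structure L, substructure N -> Prop;
  LS : Type;
  prec_in_aec : forall (N : structure L) (A : substructure N),
    prec A -> aec_in (induced A) /\ aec_in N;
  aec_iso : forall (M N : structure L) (f : M -> N),
    isomorphism f -> aec_in M -> aec_in N;
  prec_iso : forall (M N : structure L) (f : M -> N)
      (A : substructure M) (B : substructure N),
    isomorphism f -> dom B = f @` dom A -> prec A -> prec B;
  prec_refl : forall N : structure L, aec_in N -> prec (full N);
  prec_trans : forall (N : structure L) (A B : substructure N),
    prec_in prec A B -> prec B -> prec A;
  prec_coherence : forall (N : structure L) (A B : substructure N),
    prec A -> prec B -> dom A `<=` dom B -> prec_in prec A B;
  aec_union : forall (N : structure L) (I : Type) (R : rel I)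
      (A : I -> substructure N),
    continuous_chain prec R A -> \bigcup_i dom (A i) = [set: N] ->
    aec_in N /\ forall i, prec (A i);
  aec_union_prec : forall (N : structure L) (I : Type) (R : rel I)
      (A : I -> substructure N) (B : substructure N),
    continuous_chain prec R A -> (forall i, prec (A i)) ->
    dom B = \bigcup_i dom (A i) -> prec B;
  LS_spec : is_LS aec_in prec LS;
  LS_min_card : forall M : structure L, aec_in M -> [set: LS] #<= [set: M]
}.

Section GaloisTypes.
Variables (L : language) (K : AEC L).

Definition K_embedding (M N : structure L) (f : M -> N) : Prop :=
  embedding f /\ exists2 B : substructure N, dom B = range f & prec K B.

Definition K_card (lambda : Type) (M : structure L) : Prop :=
  K M /\ [set: M] #= [set: lambda].

(* The extensions of M are given by K-embeddings of M, which amounts to       *)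
(* renaming the elements of N0 and N1.                                        *)
Definition amalgamation (lambda : Type) : Prop :=
  forall (M N0 N1 : structure L) (e0 : M -> N0) (e1 : M -> N1),
    K_card lambda M -> K_card lambda N0 -> K_card lambda N1 ->
    K_embedding e0 -> K_embedding e1 ->
    exists (N : structure L) (f0 : N0 -> N) (f1 : N1 -> N),
      [/\ K N, K_embedding f0, K_embedding f1 & f0 \o e0 = f1 \o e1].

Record pretype (I : Type) (M : structure L) := Pretype {
  pt_model : structure L;
  pt_base : M -> pt_model;
  pt_tuple : I -> pt_model;
  pt_baseP : K_embedding pt_base;
  pt_card : [set: pt_model] #= [set: (M + I)%type]
}.

Definition atomic_eq (I : Type) (M : structure L) (p q : pretype I M) : Prop :=
  exists (N : structure L) (f : pt_model p -> N) (g : pt_model q -> N),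
    [/\ K N, K_embedding f, K_embedding g,
        f \o @pt_base _ _ p = g \o @pt_base _ _ q &
        f \o @pt_tuple _ _ p = g \o @pt_tuple _ _ q].

Definition gtp (I : Type) (M : structure L) (p : pretype I M) :
    set (pretype I M) :=
  [set q | clos_trans _ (@atomic_eq I M) p q].

Definition gS (I : Type) (M : structure L) : Type :=
  {C : set (pretype I M) | exists p, C = gtp p}.

Definition type_bound (lambda kappa : Type) :=
  card_sup (fun M : {M : structure L | K_card lambda M} => gS kappa (sval M)).

End GaloisTypes.
Arguments type_bound {L} K lambda kappa.

(* Main.v *)
Require Import Defs.

Set Implicit Arguments.
Unset Strict Implicit.
Unset Printing Implicit Defensive.

Local Open Scope classical_set_scope.
Local Open Scope card_scope.

(** Every n+1-type over M is obtained by realizing its restriction to the first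
    n coordinates in a fixed model N of size lambda, and then choosing a 1-type
    over N; lambda-amalgamation makes atomic equivalence transitive, so that any
    realization can be moved over this N. Hence gS^(n+1)(M) has at most
    tb^n * tb^1 elements. The elements of M realize pairwise distinct 1-types,
    so that tb^1 is infinite, tb^1 * tb^1 = tb^1, and induction on n concludes. *)

(** * Cardinal arithmetic *)

Lemma sval_inj (T : Type) (P : T -> Prop) : injective (@sval T P).
Proof. by move=> x y; apply: eq_sig_hprop => z ? ?; apply: Prop_irrelevance. Qed.

Lemma card_le_injP (T U : Type) (A : set T) (B : set U) :
  A #<= B <-> exists f : {x | A x} -> {y | B y}, injective f.
Proof.
split.
  case/card_leP=> /= f.
  pose s (x : {x | A x}) : A := SigSub (mem_set (svalP x)).
  exists (fun x => exist _ (val (f (s x))) (set_mem (valP (f (s x))))) => x y.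
  case=> /val_inj e.
  have /(congr1 val) /= := @inj _ _ _ f (s x) (s y) (in_setT _) (in_setT _) e.
  exact: sval_inj.
case=> f finj; apply/card_leP/injfunPex.
pose s (y : {y | B y}) : B := SigSub (mem_set (svalP y)).
pose r (x : A) : {x | A x} := exist _ (val x) (set_mem (valP x)).
exists (s \o f \o r) => // x y _ _ /(congr1 val) /= e.
have /finj /(congr1 sval) /= : f (r x) = f (r y) by apply: sval_inj e.
exact: val_inj.
Qed.

Lemma card_leTP (T U : Type) (B : set U) :
  [set: T] #<= B <-> exists f : T -> U, injective f /\ forall x, B (f x).
Proof.
rewrite card_le_injP; split=> [[f finj]|[f [finj fB]]].
  exists (fun x => sval (f (exist _ x I))); split=> [x y e|x].
    by have /finj [] : f (exist _ x I) = f (exist _ y I) by apply: sval_inj e.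
  exact: svalP.
exists (fun x => exist _ (f (sval x)) (fB _)) => x y [/finj].
exact: sval_inj.
Qed.

Lemma card_leTTP (T U : Type) :
  [set: T] #<= [set: U] <-> exists f : T -> U, injective f.
Proof.
rewrite card_leTP; split=> [[f [finj _]]|[f finj]]; first by exists f.
by exists f.
Qed.

Lemma card_le_inj_on (T U : Type) (u : U) (A : set T) (B : set U) :
  A #<= B -> exists2 f : T -> U, (forall x, A x -> B (f x)) &
    (forall x y, A x -> A y -> f x = f y -> x = y).
Proof.
rewrite card_le_injP => -[f finj].
pose g x := if pselect (A x) is left Ax then sval (f (exist _ x Ax)) else u.
have gE x (Ax : A x) : g x = sval (f (exist _ x Ax)).
  rewrite /g; case: pselect => // Ax'; congr (sval (f (exist _ _ _))).
  exact: Prop_irrelevance.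
exists g => [x Ax|x y Ax Ay]; first by rewrite gE; apply: svalP.
rewrite !gE => e.
by have /finj [] : f (exist _ x Ax) = f (exist _ y Ay) by apply: sval_inj e.
Qed.

(** * Pairing functions on infinite sets, by Zorn's lemma *)

Section Square.
Variable X : Type.
Implicit Types (G : set (X * X * X)) (Y D : set X) (F : X -> X -> X).

Definition injective2_on Y F := forall a b a' b', Y a -> Y b -> Y a' -> Y b' ->
  F a b = F a' b' -> a = a' /\ b = b'.

(* If [D] embeds in two disjoint copies of [Y], tagged by membership in [Y],  *)
(* then a pairing function on [Y] gives one on [D].                           *)
Lemma pairing_lift Y D F (t0 t1 : X) (r : X -> X) :
    injective2_on Y F -> (forall a b, Y a -> Y b -> Y (F a b)) ->
    Y t0 -> Y t1 -> t0 <> t1 -> (forall u, D u -> Y (r u)) ->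
    (forall u v, D u -> D v -> (Y u <-> Y v) -> r u = r v -> u = v) ->
  exists2 H : X -> X -> X, injective2_on D H &
    forall u v, D u -> D v -> Y (H u v).
Proof.
move=> Finj FY Y0 Y1 t01 rY rinj.
pose s u := if pselect (Y u) then t0 else t1.
have sY u : Y (s u) by rewrite /s; case: pselect.
have sP u v : s u = s v -> (Y u <-> Y v).
  by rewrite /s; case: pselect; case: pselect => //= ? ? /esym.
(* The outer [F] packs the pair of tags with the pair of [r]-images. Decoding gives equal tags
   first, which is what [rinj] needs to recover [u] and [v]. *)
exists (fun u v => F (F (s u) (s v)) (F (r u) (r v))) => [u v u' v' Du Dv Du' Dv'|].
  case/Finj; do ?[exact: FY | by apply: FY; apply: rY].
  case/Finj => // /sP su /sP sv.
  case/Finj; do ?exact: rY.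
  by move=> ru rv; split; apply: rinj.
by move=> u v Du Dv; apply: (FY); apply: (FY) => //; apply: rY.
Qed.

(** A triple [(a, b, c)] in [G] codes that the pair of [a] and [b] may be sent to [c]. Reading the
    domain off the diagonal lets a bare set of triples, ordered by inclusion, carry a partial
    pairing function together with its domain. *)
Definition field G : set X := [set x | exists c, G (x, x, c)].

Record pairing_graph G : Prop := PairingGraph {
  graph_inj : forall a b a' b' c, G (a, b, c) -> G (a', b', c) -> a = a' /\ b = b';
  graph_field : forall a b c, G (a, b, c) -> [/\ field G a, field G b & field G c];
  graph_total : forall a b, field G a -> field G b -> exists c, G (a, b, c)
}.

Lemma pairing_graph_fun G (x0 : X) : pairing_graph G ->
  exists F, [/\ injective2_on (field G) F,
    (forall a b, field G a -> field G b -> field G (F a b)) &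
    (forall a b, field G a -> field G b -> G (a, b, F a b))].
Proof.
case=> Ginj Gfield Gtot.
have /choice [F FP] : forall ab : X * X, exists c,
    field G ab.1 -> field G ab.2 -> G (ab.1, ab.2, c).
  case=> a b /=; have [[Ga Gb]|nab] := pselect (field G a /\ field G b).
    by have [c] := Gtot _ _ Ga Gb; exists c.
  (* [x0] is only a default value for pairs outside the field. *)
  by exists x0 => Ga Gb; case: nab.
exists (fun a b => F (a, b)); split=> [a b a' b' Ga Gb Ga' Gb' e|a b Ga Gb|a b Ga Gb].
- have := FP (a, b) Ga Gb; have := FP (a', b') Ga' Gb'.
  by rewrite /= -e => h' h; apply: Ginj h h'.
- by have [] := Gfield _ _ _ (FP (a, b) Ga Gb).
- exact: FP (a, b) Ga Gb.
Qed.

(** Each clause involves at most two triples, and two triples of the union already lie in a common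
    member of the chain. *)
Lemma pairing_graph_bigcup (F : set (set (X * X * X))) :
  F `<=` pairing_graph -> total_on F subset -> pairing_graph (\bigcup_(G in F) G).
Proof.
move=> FP Ftot.
have fieldS G G' : G `<=` G' -> field G `<=` field G'.
  by move=> GG' x [c /GG' ?]; exists c.
split=> [a b a' b' c [G FG h] [G' FG' h']|a b c [G FG h]|a b [c [G FG h]] [c' [G' FG' h']]].
- have [s|s] := Ftot _ _ FG FG'.
    by apply: (graph_inj (FP _ FG')) (s _ h) h'.
  by apply: (graph_inj (FP _ FG)) h (s _ h').
- have sG : G `<=` \bigcup_(G in F) G by move=> x Gx; exists G.
  by have [ha hb hc] := graph_field (FP _ FG) h; split; apply: fieldS sG _ _.
- have [s|s] := Ftot _ _ FG FG'.
    have [||d hd] := @graph_total _ (FP _ FG') a b; [by exists c; apply: s|by exists c'|].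
    by exists d, G'.
  have [||d hd] := @graph_total _ (FP _ FG) a b; [by exists c|by exists c'; apply: s|].
  by exists d, G.
Qed.

(** The starting graph for Zorn's lemma: a copy of the natural numbers with a pairing of them. The
    two distinct points later serve as tags. *)
Lemma pairing_graph_nat : infinite_set [set: X] ->
  exists2 G, pairing_graph G & exists t0 t1, [/\ field G t0, field G t1 & t0 <> t1].
Proof.
move=> /infiniteP /card_leTTP [i iinj].
have /card_eqPle [/card_leTTP [p pinj] _] := card_nat2.
pose G : set (X * X * X) := [set (i mn.1, i mn.2, i (p mn)) | mn in [set: nat * nat]].
have fG m : field G (i m) by exists (i (p (m, m))), (m, m).
exists G; last first.
  by exists (i 0), (i 1); split=> // /iinj.
split.
- move=> a b a' b' c [[m n] _ [<- <- <-]] [[m' n'] _ [<- <- /iinj /pinj [-> ->]]].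
  by [].
- by move=> a b c [[m n] _ [<- <- <-]].
- move=> a b [c [[m _] _ [<- _ _]]] [c' [[n _] _ [<- _ _]]].
  by exists (i (p (m, n))), (m, n).
Qed.

Lemma pairing_graph_max G0 : pairing_graph G0 ->
  exists G, [/\ pairing_graph G, G0 `<=` G &
    forall G', pairing_graph G' -> G `<=` G' -> G' `<=` G].
Proof.
move=> pG0.
(* Joining [G0] to every candidate forces the maximal graph to lie above [G0]. *)
have [F FP Ftot|G [pG Gmax]] := @Zorn_bigcup _ [set G | pairing_graph (G0 `|` G)].
  rewrite /=.
  (* [G0] is itself added to the family, so that the empty chain is covered too. *)
  have -> : G0 `|` \bigcup_(G in F) G =
      \bigcup_(G in G0 |` [set G0 `|` G | G in F]) G.
    apply/seteqP; split=> [x [G0x|[G FG Gx]]|x [G [->|[H FH <-]]]].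
    - by exists G0 => //; left.
    - by exists (G0 `|` G); [right; exists G|right].
    - by left.
    - by case=> [?|?]; [left|right; exists H].
  apply: pairing_graph_bigcup => [G [->//|[H FH <-]]|G G']; first exact: FP.
  move=> [->|[H FH <-]] [->|[H' FH' <-]]; [by left|by left; left|by right; left|].
  by have [s|s] := Ftot _ _ FH FH'; [left|right]; apply: setUS.
exists (G0 `|` G); split=> // G' pG' sGG' x G'x.
apply: contrapT => nGx; apply: (Gmax G').
  split=> [y Gy|sG'G]; first by apply: sGG'; right.
  by apply: nGx; right; apply: sG'G.
rewrite /=; have -> // : G0 `|` G' = G'.
by apply/setUidPr => y G0y; apply: sGG'; left.
Qed.

(** The new field [D] is the old field [Y] with its disjoint copy under [h]. Pairs from [Y] keep
    their values in [Y]; every other pair is coded in [Y] by the lifted pairing [H] and then moved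
    by [h] outside [Y], so old and new values never collide. *)
Lemma pairing_graph_extend G (t0 t1 : X) (h : X -> X) :
    pairing_graph G -> field G t0 -> field G t1 -> t0 <> t1 ->
    (forall x, field G x -> ~ field G (h x)) ->
    (forall x y, field G x -> field G y -> h x = h y -> x = y) ->
  exists G', [/\ pairing_graph G', G `<=` G' & ~ G' `<=` G].
Proof.
move=> pG Y0 Y1 t01 hN hinj; have [F [Finj FY _]] := pairing_graph_fun t0 pG.
set Y := field G in Y0 Y1 hN hinj Finj FY.
pose D := Y `|` h @` Y.
(* [r] is the identity on [Y] and the inverse of [h] on the copy. *)
have /choice [r rP] : forall u, exists x, (Y u -> x = u) /\
    (D u -> ~ Y u -> Y x /\ h x = u).
  move=> u; have [Yu|nYu] := pselect (Y u); first by exists u.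
  have [[//|[x Yx hx]]|nDu] := pselect (D u); first by exists x; split.
  by exists u; split.
have [u Du|u v Du Dv uv ruv|H Hinj HY] := pairing_lift (D := D) (r := r) Finj FY Y0 Y1 t01.
- by have [r1 r2] := rP u; have [Yu|/r2[]//] := pselect (Y u); rewrite r1.
- have [r1 r2] := rP u; have [r1' r2'] := rP v.
  have [Yu|nYu] := pselect (Y u); first by rewrite -r1 // -r1' //; apply/uv.
  have [_ <-] := r2 Du nYu; have [|_ <-] := r2' Dv; first by move/uv.
  by rewrite ruv.
pose G' : set (X * X * X) := G `|`
  [set x | [/\ D x.1.1, D x.1.2, ~ (Y x.1.1 /\ Y x.1.2) & x.2 = h (H x.1.1 x.1.2)]].
have fG' : field G' = D.
  apply/seteqP; split=> [x [c [/(graph_field pG)[]|[]//]]|x Dx]; first by left.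
  have [[c Gc]|nYx] := pselect (Y x); first by exists c; left.
  by exists (h (H x x)); right; split=> //= -[].
exists G'; split; last 1 first.
- move=> sG'G.
  have /sG'G/(graph_field pG)[/(hN _ Y0)//] : G' (h t0, h t0, h (H (h t0) (h t0))).
  by right; split=> //=; [right; exists t0|right; exists t0|case=> /(hN _ Y0)].
- split; rewrite ?fG'.
  + move=> a b a' b' c [Gc|[/= Da Db nab ->]] [Gc'|[/= Da' Db' nab' e]].
    * exact: graph_inj Gc Gc'.
    * have [_ _] := graph_field pG Gc; rewrite e => Yh.
      by case: (hN _ _ Yh); apply: HY.
    * have [_ _ Yh] := graph_field pG Gc'.
      by case: (hN _ _ Yh); apply: HY.
    * by apply: Hinj => //; apply: hinj e; apply: HY.
  + move=> a b c [/(graph_field pG)[]|[/= Da Db _ ->]].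
      by split; left.
    by split=> //; right; exists (H a b) => //; apply: HY.
  + move=> a b Da Db; have [[Ya Yb]|nab] := pselect (Y a /\ Y b).
      by have [c Gc] := graph_total pG Ya Yb; exists c; left.
    by exists (h (H a b)); right.
- by move=> x; left.
Qed.

(* The field [Y] of a maximal pairing graph has the cardinality of [X], since *)
(* a copy of [Y] outside [Y] would allow to extend the graph.                 *)
Lemma pairing_exists : infinite_set [set: X] ->
  exists F, injective2_on [set: X] F.
Proof.
move=> /pairing_graph_nat[G0 pG0 [t0 [t1 [Y0 Y1 t01]]]].
have [G [pG sG0G Gmax]] := pairing_graph_max pG0.
have {}Y0 : field G t0 by have [c /sG0G Gc] := Y0; exists c.
have {}Y1 : field G t1 by have [c /sG0G Gc] := Y1; exists c.
have [|] := card_le_total (field G) (~` field G).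
  move=> /(card_le_inj_on t0)[h hN hinj].
  have [G' [pG' sGG' []]] := pairing_graph_extend pG Y0 Y1 t01 hN hinj.
  exact: Gmax.
(* Otherwise the complement embeds in the field by [k], so [X] itself fits in two tagged copies of
   the field and the pairing lifts to all of [X]. *)
move=> /(card_le_inj_on t0)[k kY kinj].
have [F [Finj FY _]] := pairing_graph_fun t0 pG.
pose r u := if pselect (field G u) then u else k u.
have [u _|u v _ _|H Hinj _] := pairing_lift (D := [set: X]) (r := r) Finj FY Y0 Y1 t01.
- by rewrite /r; case: pselect => //= /kY.
- by rewrite /r; case: pselect => /= [?|nu]; case: pselect => /= [?|nv] uv //;
    [case: nv; apply/uv|case: nu; apply/uv|apply: kinj].
- by exists H.
Qed.

End Square.

Lemma infinite_pairing (T : Type) (B : set T) :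
  infinite_set B -> exists2 F : T -> T -> T, injective2_on B F &
    forall a b, B a -> B b -> B (F a b).
Proof.
move=> /infiniteP /card_leTP[i [iinj iB]].
have : infinite_set [set: {x | B x}].
  apply/infiniteP/card_leTTP; exists (fun m => exist _ (i m) (iB m)).
  by move=> m n [/iinj].
move=> /pairing_exists[F Finj].
have [p pK] : exists p : T -> {x | B x}, forall x, B x -> sval (p x) = x.
  exists (fun x => if pselect (B x) is left Bx then exist _ x Bx
                   else exist _ _ (iB 0)) => x Bx.
  by case: pselect.
exists (fun a b => sval (F (p a) (p b))) => [a b a' b' Ba Bb Ba' Bb' e|a b _ _].
  have /Finj [] // : F (p a) (p b) = F (p a') (p b') by apply: sval_inj e.
  by move=> /(congr1 sval) + /(congr1 sval); rewrite !pK.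
exact: svalP.
Qed.

(** The index and the element of its fibre are both coded in [B], then paired inside [B]. *)
Lemma card_le_sigT (T U : Type) (B : set U) (F : T -> Type) :
    infinite_set B -> [set: T] #<= B -> (forall t, [set: F t] #<= B) ->
  [set: {t & F t}] #<= B.
Proof.
move=> Binf /card_leTP[f [finj fB]] FB.
have [P Pinj PB] := infinite_pairing Binf.
pose g t := cid (iffLR (card_leTP _ _) (FB t)).
have gB t x : B (sval (g t) x) by have [_] := svalP (g t); apply.
apply/card_leTP; exists (fun x => P (f (projT1 x)) (sval (g (projT1 x)) (projT2 x))).
split=> [[t x] [u y] /= e|x]; last exact: PB.
have [//|//|//|//|/finj tu] := Pinj _ _ _ _ _ _ _ _ e; subst u; have [ginj _] := svalP (g t).
by move=> /ginj ->.
Qed.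

Lemma card_le_sum (T U V : Type) (B : set V) :
    infinite_set B -> [set: T] #<= B -> [set: U] #<= B ->
  [set: (T + U)%type] #<= B.
Proof.
move=> Binf TB UB.
(* A sum is a family indexed by [bool], which embeds in the infinite set [B]. *)
pose F (b : bool) : Type := if b then T else U.
have /card_leTP[f [finj fB]] : [set: {b & F b}] #<= B.
  apply: card_le_sigT => // [|[]//].
  apply: card_le_trans (iffLR (infiniteP B) Binf).
  by apply/card_leTTP; exists nat_of_bool; case; case.
apply/card_leTP; exists (fun x => match x with
  inl t => f (existT F true t) | inr u => f (existT F false u) end).
by split=> [[x|x] [y|y] /finj // e|[x|x] //]; have /= := projT2_eq e;
  rewrite (Prop_irrelevance (projT1_eq e) erefl) /= => ->.
Qed.

Lemma card_sum_ord (T : Type) (n : nat) :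
  infinite_set [set: T] -> [set: (T + 'I_n)%type] #= [set: T].
Proof.
move=> Tinf; apply/card_eqPle; split; last by apply/card_leTTP; exists inl => x y [].
apply: card_le_sum => //; apply: card_le_trans (iffLR (infiniteP _) Tinf).
by apply/card_leTTP; exists (@nat_of_ord n); apply: val_inj.
Qed.
(** * Embeddings and types *)

Section Embeddings.
Variables (L : language) (K : AEC L).

Lemma embedding_comp (M N P : structure L) (f : M -> N) (g : N -> P) :
  embedding f -> embedding g -> embedding (g \o f).
Proof.
move=> [finj ff fr] [ginj gf gr]; split=> [x y /ginj /finj //|s x|s x].
- by rewrite /= ff gf.
- by split=> [/fr /gr|/gr /fr].
Qed.

Lemma range_closed (M N : structure L) (f : M -> N) : embedding f ->
  forall (s : fsym L) (x : 'I_(far s) -> N),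
    (forall i, range f (x i)) -> range f (finterp x).
Proof.
move=> fe s x xf.
have /choice [y yP] : forall i, exists y, f y = x i.
  by move=> i; have [y _ <-] := xf i; exists y.
by exists (finterp y) => //; rewrite (emb_fun fe); congr finterp; apply/funext.
Qed.

Lemma induced_embedding (M N : structure L) (C : substructure N) (f : M -> N)
    (fC : forall x, dom C (f x)) :
  embedding f -> @embedding L M (induced C) (fun x => exist _ (f x) (fC x)).
Proof.
move=> [finj ff fr]; split=> [x y [/finj //]|s x|s x].
- by apply: sval_inj; rewrite /= ff.
- exact: fr.
Qed.

Lemma K_embedding_in (M N : structure L) (f : M -> N) : K_embedding K f -> K N.
Proof. by case=> _ [B _ pB]; have [] := prec_in_aec pB. Qed.

Lemma K_embedding_id (M : structure L) : K M -> K_embedding K (@id M).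
Proof.
move=> KM; split; first by split.
exists (full M); last exact: prec_refl.
by apply/seteqP; split=> // x _; exists x.
Qed.

(** [g] is an isomorphism onto the structure induced on its range, so it carries the strong range of
    [f] to a strong substructure of that range; transitivity of [prec] concludes. *)
Lemma K_embedding_comp (M N P : structure L) (f : M -> N) (g : N -> P) :
  K_embedding K f -> K_embedding K g -> K_embedding K (g \o f).
Proof.
move=> [fe [B Bf pB]] [ge [C Cg pC]]; have gfe := embedding_comp fe ge.
split=> //; pose A := Substructure (range_closed gfe).
exists A => //; apply: (@prec_trans _ K _ A C) => //; split.
  by rewrite Cg => _ [x _ <-]; exists (f x).
have gC x : dom C (g x) by rewrite Cg; exists x.
have hiso : @isomorphism L N (induced C) (fun x => exist _ (g x) (gC x)).
  split; first exact: induced_embedding.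
  apply/seteqP; split=> // -[y Cy] _.
  have [x _ gx] : range g y by rewrite -Cg.
  by exists x => //; apply: sval_inj.
apply: (prec_iso hiso _ pB); apply/seteqP; split.
  move=> [y Cy] /= [x _ gfx]; exists (f x); first by rewrite Bf; exists x.
  exact: sval_inj.
by move=> _ [y + <-]; rewrite Bf => -[x _ <-]; exists x.
Qed.

(** This is coherence: the range of [f] and [C] are both strong in [N]. *)
Lemma K_embedding_restrict (M N : structure L) (C : substructure N) (f : M -> N)
    (fC : forall x, dom C (f x)) :
  prec K C -> K_embedding K f ->
  @K_embedding L K M (induced C) (fun x => exist _ (f x) (fC x)).
Proof.
move=> pC [fe [B Bf pB]]; split; first exact: induced_embedding.
have [|_ pBC] := prec_coherence pB pC; first by rewrite Bf => _ [x _ <-].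
exists (relativize B C) => //; apply/seteqP; split.
  move=> [y Cy] By; have [x _ fx] : range f y by rewrite -Bf.
  exists x => //.
  exact: sval_inj.
by move=> _ [x _ <-] /=; rewrite Bf; exists x.
Qed.

End Embeddings.

(** * Atomic equivalence and Galois types under amalgamation *)

Section Types.
Variables (L : language) (K : AEC L) (lambda : Type).
Hypothesis hAP : amalgamation K lambda.
Hypothesis hLS : [set: LS K] #<= [set: lambda].

Lemma lambda_infinite : infinite_set [set: lambda].
Proof.
have [[LSinf _ _] _] := LS_spec K.
by move=> /(card_le_finite hLS).
Qed.

Lemma K_card_infinite (M : structure L) : K_card K lambda M -> infinite_set [set: M].
Proof.
move=> [_ /card_eqPle[_ lM]] Mfin.
exact: lambda_infinite (card_le_finite lM Mfin).
Qed.

(** Atomic equivalence allows a target of any size, while amalgamation concerns models of size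
    [lambda]. Löwenheim-Skolem, applied to the union of the two ranges, gives a small target [P];
    injectivity of [h] pulls equations in [N] back to [P]. *)
Lemma cocone_shrink (N0 N1 N : structure L) (f0 : N0 -> N) (f1 : N1 -> N) :
    K_card K lambda N0 -> K_card K lambda N1 ->
    K_embedding K f0 -> K_embedding K f1 ->
  exists (P : structure L) (g0 : N0 -> P) (g1 : N1 -> P) (h : P -> N),
    [/\ K_card K lambda P, K_embedding K g0, K_embedding K g1 &
        f0 = h \o g0 /\ f1 = h \o g1 /\ injective h].
Proof.
move=> KN0 KN1 f0K f1K.
have [[_ _ LSb] _] := LS_spec K.
have [A [pA sA cA]] := LSb N (range f0 `|` range f1) (K_embedding_in f0K).
have f0A x : dom A (f0 x) by apply: sA; left; exists x.
have f1A x : dom A (f1 x) by apply: sA; right; exists x.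
exists (induced A), (fun x => exist _ (f0 x) (f0A x)), (fun x => exist _ (f1 x) (f1A x)), sval.
split; [|exact: K_embedding_restrict|exact: K_embedding_restrict|]; last first.
  by do 2!split=> //; move=> x y; apply: sval_inj.
split; first by have [] := prec_in_aec pA.
have [_ /card_eqPle[N0l lN0]] := KN0; have [_ /card_eqPle[N1l lN1]] := KN1.
have [/emb_inj f0i _] := f0K.
apply/card_eqPle; split; last first.
  apply: card_le_trans lN0 _; apply/card_leTTP.
  by exists (fun x => exist _ (f0 x) (f0A x)) => x y [/f0i].
have dA : [set: induced A] #<= dom A.
  by apply/card_leTP; exists sval; split=> [x y|x]; [apply: sval_inj|apply: svalP].
apply: card_le_trans dA (card_le_trans cA _).
apply: card_le_sum => //; first exact: lambda_infinite.
have : [set: (N0 + N1)%type] #<= [set: lambda].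
  by apply: card_le_sum => //; exact: lambda_infinite.
apply: card_le_trans.
(* Choosing preimages embeds the union of the ranges in [N0 + N1]. *)
have /choice [g gP] : forall x : {x | (range f0 `|` range f1) x},
    exists y : N0 + N1, match y with inl a => f0 a | inr b => f1 b end = sval x.
  by case=> x /= [[a _ <-]|[b _ <-]]; [exists (inl a)|exists (inr b)].
apply/card_leTTP; exists g => x y e; apply: sval_inj => //.
by rewrite -gP e gP.
Qed.

Section OverModel.
Variables (M : structure L) (hM : K_card K lambda M).

Lemma pt_K_card (n : nat) (p : pretype K 'I_n M) : K_card K lambda (pt_model p).
Proof.
split; first exact: K_embedding_in (pt_baseP p).
apply: card_eq_trans (pt_card p) _.
by apply: card_eq_trans (card_sum_ord _ (K_card_infinite hM)) _; case: hM.
Qed.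

(** Discharges the size condition of pretypes: finitely many extra points do not change the size of
    the infinite model [M]. *)
Lemma K_card_pt (n : nat) (N : structure L) :
  K_card K lambda N -> [set: N] #= [set: (M + 'I_n)%type].
Proof.
move=> [_ cN]; apply: card_eq_trans cN _; apply: card_esym.
by apply: card_eq_trans (card_sum_ord _ (K_card_infinite hM)) _; case: hM.
Qed.

Lemma atomic_eq_refl (n : nat) (p : pretype K 'I_n M) : atomic_eq p p.
Proof.
have [KN _] := pt_K_card p.
by exists (pt_model p), id, id; split=> //; apply: K_embedding_id.
Qed.

(** Both witnesses are shrunk to size [lambda], then amalgamated over the model of the middle
    pretype [q]. *)
Lemma atomic_eq_trans (n : nat) (p q r : pretype K 'I_n M) :
  atomic_eq p q -> atomic_eq q r -> atomic_eq p r.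
Proof.
move=> [N [f [g [_ fK gK bfg tfg]]]] [N' [f' [g' [_ f'K g'K bfg' tfg']]]].
have [P [u [v [h [KP uK vK [fh [gh hi]]]]]]] :=
  cocone_shrink (pt_K_card p) (pt_K_card q) fK gK.
have [P' [u' [v' [h' [KP' u'K v'K [fh' [gh' hi']]]]]]] :=
  cocone_shrink (pt_K_card q) (pt_K_card r) f'K g'K.
have [Q [w [w' [KQ wK w'K ww']]]] := hAP (pt_K_card q) KP KP' vK u'K.
exists Q, (w \o u), (w' \o v'); split=> //; try exact: K_embedding_comp.
- apply/funext => x /=.
  have /hi -> : h (u (pt_base p x)) = h (v (pt_base q x)).
    by have := congr1 (fun k => k x) bfg; rewrite fh gh.
  have /hi' <- : h' (u' (pt_base q x)) = h' (v' (pt_base r x)).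
    by have := congr1 (fun k => k x) bfg'; rewrite fh' gh'.
  by have := congr1 (fun k => k (pt_base q x)) ww'.
- apply/funext => x /=.
  have /hi -> : h (u (pt_tuple p x)) = h (v (pt_tuple q x)).
    by have := congr1 (fun k => k x) tfg; rewrite fh gh.
  have /hi' <- : h' (u' (pt_tuple q x)) = h' (v' (pt_tuple r x)).
    by have := congr1 (fun k => k x) tfg'; rewrite fh' gh'.
  by have := congr1 (fun k => k (pt_tuple q x)) ww'.
Qed.

Lemma gtpP (n : nat) (p q : pretype K 'I_n M) : gtp p = gtp q <-> atomic_eq p q.
Proof.
have ct r s : clos_trans _ (@atomic_eq _ K 'I_n M) r s <-> atomic_eq r s.
  split=> [|rs]; last exact: t_step.
  by elim=> // x y z _ xy _; apply: atomic_eq_trans.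
split=> [e|pq].
  by apply/ct; suff: gtp p q by []; rewrite e; apply/ct; apply: atomic_eq_refl.
have qp : atomic_eq q p.
  by have [N [f [g [? ? ? e e']]]] := pq; exists N, g, f.
by apply/seteqP; split=> r /ct h; apply/ct; apply: atomic_eq_trans h.
Qed.

Definition gtype (n : nat) (p : pretype K 'I_n M) : gS K 'I_n M :=
  exist _ (gtp p) (ex_intro _ p erefl).

Definition representative (n : nat) (t : gS K 'I_n M) : pretype K 'I_n M :=
  sval (cid (svalP t)).

Lemma representativeK (n : nat) (t : gS K 'I_n M) : gtype (representative t) = t.
Proof. by apply: sval_inj; rewrite /= -(svalP (cid (svalP t))). Qed.

Lemma gtype_eqP (n : nat) (p q : pretype K 'I_n M) : gtype p = gtype q <-> atomic_eq p q.
Proof.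
rewrite -gtpP; split=> [[//]|e].
exact: sval_inj.
Qed.

(** With no coordinates to match, amalgamating the two models over [M] already gives an atomic
    equivalence. *)
Lemma gS0_eq (s t : gS K 'I_0 M) : s = t.
Proof.
rewrite -(representativeK s) -(representativeK t); apply/gtype_eqP.
move: (representative s) (representative t) => p q.
have [N [f [g [KN fK gK e]]]] :=
  hAP hM (pt_K_card p) (pt_K_card q) (pt_baseP p) (pt_baseP q).
by exists N, f, g; split=> //; apply/funext => -[].
Qed.

Lemma card_le_gS1 : [set: M] #<= [set: gS K 'I_1 M].
Proof.
have [KM _] := hM.
pose p (m : M) : pretype K 'I_1 M :=
  Pretype (fun=> m) (K_embedding_id KM) (K_card_pt 1 hM).
apply/card_leTTP; exists (fun m => gtype (p m)) => m m' /gtype_eqP.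
move=> [N [f [g [_ fK [/emb_inj gi _] /= efg tfg]]]].
(* Agreement on the base and on the tuples gives [g m = f m = g m']. *)
apply: gi; transitivity (f m); first by have := congr1 (fun k => k m) efg.
by have := congr1 (fun k => k ord0) tfg.
Qed.

Definition pt_init (n : nat) (p : pretype K 'I_n.+1 M) : pretype K 'I_n M :=
  Pretype (pt_tuple p \o lift ord_max) (pt_baseP p) (K_card_pt n (pt_K_card p)).

End OverModel.

(** * Adding one coordinate to a type *)

Section Extension.
Variables (M : structure L) (hM : K_card K lambda M) (n : nat).

Definition rcons_tuple (N N' : Type) (b : N -> N') (a : 'I_n -> N) (c : 'I_1 -> N')
    (i : 'I_n.+1) : N' :=
  if unlift ord_max i is Some j then b (a j) else c ord0.

Lemma pt_rcons_card (p : pretype K 'I_n M) (q : pretype K 'I_1 (pt_model p)) :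
  [set: pt_model q] #= [set: (M + 'I_n.+1)%type].
Proof. exact: K_card_pt (pt_K_card (pt_K_card hM p) q). Qed.

Definition pt_rcons (p : pretype K 'I_n M) (q : pretype K 'I_1 (pt_model p)) :
    pretype K 'I_n.+1 M :=
  Pretype (rcons_tuple (@pt_base _ _ _ _ q) (@pt_tuple _ _ _ _ p) (@pt_tuple _ _ _ _ q))
    (K_embedding_comp (pt_baseP p) (pt_baseP q)) (pt_rcons_card q).

(** Using the chosen representative of [s] makes the model under the second component depend on [s]
    alone, so the pairs form a sigma type that can be counted fibrewise. *)
Lemma gtype_rcons_onto (t : gS K 'I_n.+1 M) :
  exists st : {s : gS K 'I_n M & gS K 'I_1 (pt_model (representative s))},
    t = gtype (pt_rcons (representative (projT2 st))).
Proof.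
set r := representative t.
pose s := gtype (pt_init hM r); set p := representative s.
have /(gtype_eqP hM) [N [f0 [g0 [_ f0K g0K b0 t0]]]] : gtype p = gtype (pt_init hM r).
  exact: representativeK.
have [P [f [g [h [KP fK gK [f0E [g0E hi]]]]]]] :=
  cocone_shrink (pt_K_card hM p) (pt_K_card hM r) f0K g0K.
have hp := pt_K_card hM p.
(* [P] contains the models of [p] and [r] with their first [n] coordinates identified; the last
   coordinate of [r], seen in [P], realizes the required 1-type over the model of [p]. *)
pose q0 : pretype K 'I_1 (pt_model p) :=
  Pretype (fun=> g (pt_tuple r ord_max)) fK (K_card_pt hp 1 KP).
exists (existT _ s (gtype q0)) => /=; set q := representative (gtype q0).
have /(gtype_eqP hp) [Q [u [v [KQ uK vK bq tq]]]] : gtype q = gtype q0.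
  exact: representativeK.
rewrite -(representativeK t) -/r; apply/esym/(gtype_eqP hM).
(* The model of [r] reaches [Q] through [P]. The base and the first [n] coordinates agree already in
   [P]; the last one agrees by the equivalence of [q] and [q0]. *)
exists Q, u, (v \o g); split=> //; first exact: K_embedding_comp.
- apply/funext => x /=; have := congr1 (fun k => k (pt_base p x)) bq => /= ->.
  congr v; apply: hi; have := congr1 (fun k => k x) b0.
  by rewrite f0E g0E.
- apply/funext => i /=; rewrite /rcons_tuple; case: unliftP => [j ->|->].
    have := congr1 (fun k => k (pt_tuple p j)) bq => /= ->.
    congr v; apply: hi; have := congr1 (fun k => k j) t0.
    by rewrite f0E g0E.
  by have := congr1 (fun k => k ord0) tq.
Qed.

End Extension.

(** The bound on 1-types is assumed over all models of size [lambda], because the induction step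
    counts 1-types over the models of representatives instead of over [M]. *)
Lemma card_le_gS (T : Type) (B : set T) :
    (forall M, K_card K lambda M -> [set: gS K 'I_1 M] #<= B) ->
  forall n M, K_card K lambda M -> [set: gS K 'I_n M] #<= B.
Proof.
move=> hB n M hM.
have Binf : infinite_set B.
  have le := card_le_trans (card_le_gS1 hM) (hB M hM).
  by move=> /(card_le_finite le); apply: K_card_infinite.
elim: n => [|n IHn].
  have /infiniteP /card_leTP [i [_ iB]] := Binf.
  apply/card_leTP; exists (fun=> i 0); split=> // s t _; exact: gS0_eq.
pose F (s : gS K 'I_n M) := gS K 'I_1 (pt_model (representative s)).
have /card_le_trans : [set: gS K 'I_n.+1 M] #<= [set: {s & F s}].
  (* [c] is a section of a surjection, hence injective. *)
  have /choice [c cP] := gtype_rcons_onto (M := M) hM (n := n).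
  by apply/card_leTTP; exists c => t t' e; rewrite (cP t) (cP t') e.
apply; apply: card_le_sigT => // s; apply: hB; exact: pt_K_card.
Qed.

End Types.

Theorem theorem3p3 (L : language) (K : AEC L) (lambda : Type)
    (hAP : amalgamation K lambda)
    (hLS : [set: LS K] #<= [set: lambda])
    (n : nat) :
  type_bound K lambda 'I_n #<= type_bound K lambda 'I_1.
Proof.
have [ub1 _] := card_supP (fun M : {M | K_card K lambda M} => gS K 'I_1 (sval M)).
have [_ min_n] := card_supP (fun M : {M | K_card K lambda M} => gS K 'I_n (sval M)).
(* The supremum for ['I_n] lies below every upper bound, so it suffices that the one for ['I_1]
   bounds each set of [n]-types. *)
apply: min_n => -[M hM]; apply: (card_le_gS hAP hLS) => // N hN.
exact: ub1 (exist _ N hN).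
Qed.
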